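(* Up to isomorphism, $\mathbb{Z}_2\times\mathbb{Z}_2$ is the unique non-cyclic finite group $G$ satisfying $\sigma_1(G)<2+\frac{4}{|G|}$, and $S_3$ is the unique non-abelian finite group $G$ satisfying $\sigma_1(G)=2+\frac{4}{|G|}$.
   Context: For a finite group $G$, let $L(G)$ denote the set (lattice) of all subgroups of $G$, including the trivial subgroup and $G$ itself, and define $\sigma_1(G)=\sum_{H\in L(G)}\frac{|H|}{|G|}=\sum_{H\in L(G)}\frac{1}{|G:H|}$. $\mathbb{Z}_m$ is the cyclic group of order $m$, and $S_3$ is the symmetric group on three letters. *)

(* Defs.v *)
From mathcomp Require Import all_boot all_order all_algebra all_fingroup all_solvable.

Set Implicit Arguments.
Unset Strict Implicit.
Unset Printing Implicit Defensive.

Import Order.TTheory GRing.Theory Num.Theory.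

Local Open Scope ring_scope.

(* The lattice L(G) is the library's set [subgroups G] of all groups H \subset G;
   G is a subgroup of an ambient group gT, and the value does not depend on gT. *)
Definition sigma1 (gT : finGroupType) (G : {group gT}) : rat :=
  \sum_(H in subgroups G) (#|H|%:R / #|G|%:R).

(* The carriers 'Z_2 below are used through their additive group law, which is
   the canonical finGroupType structure of 'Z_2. *)
Definition klein4 : {group 'Z_2 * 'Z_2} := [set: 'Z_2 * 'Z_2]%G.

Definition sym3 : {group 'S_3} := [set: 'S_3]%G.

(* Main.v *)
Require Import Defs.
From mathcomp Require Import all_boot all_order all_algebra all_fingroup all_solvable.

Set Implicit Arguments.
Unset Strict Implicit.
Unset Printing Implicit Defensive.

Import Order.TTheory GRing.Theory Num.Theory.

Local Open Scope ring_scope.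

(** Every element of [G] generates exactly one cyclic subgroup, so the numbers
    of generators of the subgroups of [G] add up to [#|G|]. Hence the sum of
    [#|H|] over all subgroups is [#|G|] plus the total number of pairs
    (subgroup, element of it that does not generate it). When [G] is not cyclic,
    [G] itself contributes [#|G|] such pairs, the trivial group contributes
    none, and every other subgroup contributes at least one, namely its identity
    ([sum_card_subgroups]). So [sigma1 G = 2 + excess G / #|G|], where [excess G]
    is the contribution of the proper nontrivial subgroups, and the theorem asks
    when [excess G] is less than, or equal to, 4. The excess is at least the
    number of proper nontrivial subgroups, with equality only if they all have
    prime order.

    If [G] is not cyclic and [x] has maximal order, then any [y] outside [<[x]>]
    gives three pairwise incomparable subgroups [<[x]>], [<[y]>], [<[x * y]>].
    If there are no others, then all three have prime order and quotients of
    elements of [<[x * y]>] show that [x] and [y] are involutions, which forces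
    [#|G| = 4] ([card4_of_three_propers]).

    If [G] is nonabelian of excess at most 4, it therefore has exactly four
    proper nontrivial subgroups, all of prime order. They cannot all be normal,
    since distinct normal ones would commute elementwise. A nonnormal one, [A],
    is its own normaliser, so it has [m = #|G| / #|A|] conjugates, and counting
    the elements of [G] leaves [m - 1] nonidentity elements for the other [4 - m]
    subgroups. This leaves only [m = 3] with a single further subgroup, of
    order 3; the class of one of its generators has [#|A|] elements and lies in
    it, so [#|A| = 2] and [#|G| = 6] ([card6_of_nonabelian]). A nonabelian group
    of order 6 is generated by two involutions, hence is dihedral
    ([nonabelian6_isog_dihedral]), and this applies to the symmetric group. *)

(** * Generators and the excess *)

Section SubgroupCounting.

Local Open Scope nat_scope.
Local Open Scope group_scope.

Variable gT : finGroupType.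
Implicit Types (G H K A : {group gT}) (x y z : gT).

Definition nt_propers G : {set {group gT}} :=
  [set H : {group gT} | (H :!=: 1) && (H \proper G)].

Definition nongens H : nat := #|[set x in H | ~~ generator H x]|.

Definition excess G : nat := (\sum_(H in nt_propers G) nongens H)%N.

Lemma nt_propersP G H :
  reflect [/\ H :!=: 1, H \subset G & H :!=: G] (H \in nt_propers G).
Proof.
rewrite inE properEneq; apply: (iffP and3P); by case=> ? ? ?; split.
Qed.

Lemma card_gens_add_nongens H : (#|[set x | generator H x]| + nongens H = #|H|)%N.
Proof.
rewrite -(cardsID [set x | generator H x] H); congr (_ + _)%N.
  apply: eq_card => x; rewrite !inE andb_idl // => /eqP->; exact: cycle_id.
by apply: eq_card => x; rewrite !inE andbC.
Qed.

(** Each [x] in [G] is counted once, at [H = <[x]>]. *)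
Lemma sum_card_gens G :
  (\sum_(H in subgroups G) #|[set x | generator H x]| = #|G|)%N.
Proof.
rewrite -[RHS]sum1_card (partition_big (fun x => <[x]>%G) (mem (subgroups G))) /=.
  apply: eq_bigr => H; rewrite inE => sHG; rewrite -sum1dep_card; apply: eq_bigl => x.
  rewrite -val_eqE /= [_ == val H]eq_sym andb_idl // => /eqP defH.
  by rewrite -cycle_subG -defH.
by move=> x Gx; rewrite inE cycle_subG.
Qed.

Lemma nongens_noncyclic G : ~~ cyclic G -> nongens G = #|G|.
Proof.
move=> ncG; apply: eq_card => x; rewrite !inE andb_idr // => _.
by apply: contra ncG => /eqP->; apply: cycle_cyclic.
Qed.

Lemma nongens1 : nongens [1 gT]%G = 0%N.
Proof.
apply/eqP; rewrite cards_eq0; apply/eqP/setP=> x; rewrite !inE.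
by case: eqP => //= ->; rewrite /generator cycle1 eqxx.
Qed.

Lemma nongens_gt0 H : H :!=: 1 -> (0 < nongens H)%N.
Proof.
move=> ntH; apply/card_gt0P; exists 1.
by rewrite inE group1 /= /generator cycle1.
Qed.

Lemma nongens_prime H : prime #|H| -> nongens H = 1%N.
Proof.
move=> pH; apply/eqP/cards1P; exists 1; apply/setP=> x; rewrite !inE.
have [-> | ntx] := eqVneq x 1.
  by rewrite group1 /= /generator cycle1; apply: contraTneq pH => ->; rewrite cards1.
apply/andP=> -[Hx /negP[]]; rewrite /generator eq_sym eqEcard cycle_subG Hx /=.
case/primeP: pH => _ /(_ _ (order_dvdG Hx)); rewrite order_eq1 (negPf ntx) /=.
by move/eqP=> <-.
Qed.

(** An element of prime order, given by Cauchy's theorem, has to generate. *)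
Lemma prime_card_all_generators H :
  H :!=: 1 -> (forall x, x \in H -> x != 1 -> H :=: <[x]>) -> prime #|H|.
Proof.
move=> ntH minH; have pr_p: prime (pdiv #|H|) by rewrite pdiv_prime ?cardG_gt1.
have [x Hx ox] := Cauchy pr_p (pdiv_dvd _).
by rewrite (minH x) ?[#|_|]ox // -order_gt1 ox prime_gt1.
Qed.

Lemma prime_nongens1 H : H :!=: 1 -> nongens H = 1%N -> prime #|H|.
Proof.
move=> ntH /eqP/cards1P[z defz]; apply: prime_card_all_generators => // x Hx ntx.
have: 1 \in [set z] by rewrite -defz inE group1 /= /generator cycle1.
rewrite inE eq_sym => /eqP z1; apply/eqP.
by move/setP/(_ x): defz; rewrite !inE Hx z1 (negPf ntx) => /negbFE.
Qed.

(** Of the two copies of [#|G|], one counts the pairs [(<[x]>, x)], the other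
    the elements of [G], none of which generates [G]. *)
Lemma sum_card_subgroups G : ~~ cyclic G ->
  (\sum_(H in subgroups G) #|H| = 2 * #|G| + excess G)%N.
Proof.
move=> ncG; under eq_bigr do rewrite -card_gens_add_nongens.
rewrite big_split /= sum_card_gens mul2n -addnn -addnA; congr (_ + _)%N.
rewrite (bigD1 G) ?inE //= nongens_noncyclic //; congr (_ + _)%N.
rewrite (bigD1 [1 gT]%G) /=; last first.
  by rewrite inE sub1G; apply: contraNneq ncG => <-; apply: cyclic1.
rewrite nongens1 add0n; apply: eq_bigl => H.
by rewrite !inE properEneq -!val_eqE /=; do ![case: (_ \subset _) | case: (_ == _)].
Qed.

(** Distinct subgroups of prime order share only the identity, and every
    nonidentity element generates one of the proper subgroups. *)
Lemma sum_card_prime_propers G : ~~ cyclic G ->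
    (forall H, H \in nt_propers G -> prime #|H|) ->
  (\sum_(H in nt_propers G) #|H|.-1 = #|G|.-1)%N.
Proof.
move=> ncG prG; rewrite -[in RHS](sum_card_gens G).
rewrite [in RHS](bigD1 G) ?inE //= [in RHS](bigD1 [1 gT]%G) /=; last first.
  by rewrite inE sub1G; apply: contraNneq ncG => <-; apply: cyclic1.
have := card_gens_add_nongens G; rewrite nongens_noncyclic // => /eqP.
rewrite -[X in _ == X]add0n eqn_add2r => /eqP->.
have := card_gens_add_nongens [1 gT]%G; rewrite nongens1 addn0 cards1 => ->.
rewrite add0n add1n /=; apply: eq_big => [H | H LH].
  by rewrite !inE properEneq -!val_eqE /=; do ![case: (_ \subset _) | case: (_ == _)].
by have := card_gens_add_nongens H; rewrite nongens_prime ?prG // addn1 => <-.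
Qed.

Lemma leq_card_excess G : (#|nt_propers G| <= excess G)%N.
Proof.
rewrite -sum1_card; apply: leq_sum => H /nt_propersP[ntH _ _].
exact: nongens_gt0.
Qed.

Lemma excess_eq_card G :
    (forall H, H \in nt_propers G -> prime #|H|) -> excess G = #|nt_propers G|.
Proof.
by move=> prG; rewrite -sum1_card; apply: eq_bigr => H /prG/nongens_prime.
Qed.

(** Each subgroup contributes at least 1 to the excess, so a total no larger
    than their number makes every contribution equal to 1. *)
Lemma prime_of_excess_leq_card G :
    (excess G <= #|nt_propers G|)%N ->
  forall H, H \in nt_propers G -> prime #|H|.
Proof.
move=> leEL H LH; have [ntH _ _] := nt_propersP _ _ LH.
apply: prime_nongens1 => //; apply/eqP; rewrite eqn_leq nongens_gt0 // andbT.
move: leEL; rewrite /excess (bigD1 H LH) (cardsD1 H) LH /= => leEL.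
have le_rest: (#|nt_propers G :\ H| <= \sum_(K in nt_propers G | K != H) nongens K)%N.
  rewrite -sum1_card big_mkcond [leqRHS]big_mkcond; apply: leq_sum => K _.
  rewrite in_setD1 andbC; case: ifP => // /andP[/nt_propersP[ntK _ _] _].
  exact: nongens_gt0.
by rewrite -(leq_add2r #|nt_propers G :\ H|); apply: leq_trans leEL; rewrite leq_add2l.
Qed.

(** * Noncyclic groups with three proper nontrivial subgroups *)

Lemma cycle_nt_propers G x :
  ~~ cyclic G -> x \in G -> x != 1 -> <[x]>%G \in nt_propers G.
Proof.
move=> ncG Gx ntx; apply/nt_propersP; split=> /=; rewrite ?cycle_eq1 ?cycle_subG //.
by apply: contraNneq ncG => <-; apply: cycle_cyclic.
Qed.

(** The remaining relations between [<[x]>], [<[y]>] and [<[x * y]>] follow by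
    cancellation, so these three subgroups are pairwise incomparable. Without
    the maximality of [#[x]] the last conclusion could fail: the product of
    commuting elements of coprime orders generates both of them. *)
Lemma incomparable_cycles G : ~~ cyclic G ->
  exists x y, [/\ x \in G, y \in G, y \notin <[x]>, x \notin <[y]> & x \notin <[x * y]>].
Proof.
move=> ncG; have G1 := group1 G; pose x := [arg max_(z > 1 in G) #[z]].
have [Gx maxx]: x \in G /\ forall z, z \in G -> (#[z] <= #[x])%N.
  by rewrite /x; case: arg_maxnP.
(* A cyclic group containing [x] cannot be larger than [<[x]>]. *)
have memC z: z \in G -> x \in <[z]> -> z \in <[x]>.
  move=> Gz; rewrite -cycle_subG => sxz.
  suffices /eqP->: <[x]> == <[z]> by apply: cycle_id.
  by rewrite eqEcard sxz; apply: maxx.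
have /subsetPn[y Gy x'y]: ~~ (G \subset <[x]>).
  apply: contra ncG => sGx; apply/cyclicP; exists x; apply/eqP.
  by rewrite eqEsubset sGx cycle_subG.
exists x, y; split=> //; first by apply: contra x'y; apply: memC.
by apply: contra x'y => /memC; rewrite groupM // groupMl ?cycle_id //; apply.
Qed.

(** The incomparable subgroups [<[x]>], [<[y]>], [<[x * y]>] are then all the
    proper nontrivial ones; being minimal they have prime order and meet
    trivially. *)
Lemma card4_of_three_propers G :
  ~~ cyclic G -> (#|nt_propers G| <= 3)%N -> #|G| = 4.
Proof.
move=> ncG le3.
have [x [y [Gx Gy x'y y'x xy'x]]] := incomparable_cycles ncG.
have xy'y: y \notin <[x * y]>.
  by apply: contra xy'x => xyy; rewrite -(groupMr _ xyy) cycle_id.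
have x'xy: x * y \notin <[x]> by rewrite groupMl ?cycle_id.
have y'xy: x * y \notin <[y]> by rewrite groupMr ?cycle_id.
have nt z H: z \notin H -> z != 1 by apply: contraNneq => ->.
have neqC (u v : gT): u \notin <[v]> -> (<[v]>%G == <[u]>%G) = false.
  by move=> v'u; apply: contraNF v'u => /eqP/(congr1 val)/= ->; apply: cycle_id.
have neqC' (u v : gT): u \notin <[v]> -> (<[u]>%G == <[v]>%G) = false.
  by rewrite eq_sym; apply: neqC.
pose T := [set <[x]>%G; <[y]>%G; <[x * y]>%G].
have defL: nt_propers G = T.
  apply/eqP; rewrite eq_sym eqEcard; apply/andP; split.
    apply/subsetP=> H; rewrite !in_setU !in_set1 -orbA.
    by case/or3P=> /eqP->; apply: cycle_nt_propers; rewrite ?groupM //;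
      apply: nt; eassumption.
  apply: leq_trans le3 _.
  by rewrite /T -setUA !cardsU1 cards1 !inE !neqC.
have LT z: z \in G -> z \notin <[x]> -> z \notin <[y]> -> z \in <[x * y]>.
  move=> Gz x'z y'z; have: <[z]>%G \in T by rewrite -defL cycle_nt_propers ?(nt _ _ x'z).
  by rewrite !inE (neqC' _ _ x'z) (neqC' _ _ y'z) /= => /eqP/(congr1 val)/= <-; apply: cycle_id.
have minL H K: H \in T -> K \in T -> H \subset K -> H = K.
  rewrite !inE -!orbA => /or3P[] /eqP-> /or3P[] /eqP-> //=;
  by rewrite cycle_subG ?(negPf x'y, negPf y'x, negPf xy'x, negPf xy'y, negPf x'xy, negPf y'xy).
have prG H: H \in T -> prime #|H|.
  move=> TH; have: H \in nt_propers G by rewrite defL.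
  case/nt_propersP=> ntH sHG _; apply: prime_card_all_generators => // u Hu ntu.
  rewrite -(minL <[u]>%G H) ?cycle_subG // -defL cycle_nt_propers //.
  exact: (subsetP sHG).
have Tx: <[x]>%G \in T by rewrite !inE eqxx.
have Ty: <[y]>%G \in T by rewrite !inE eqxx orbT.
have Txy: <[x * y]>%G \in T by rewrite !inE eqxx !orbT.
have TI H u: H \in T -> u \in H -> u \in <[x * y]> -> H != <[x * y]>%G -> u = 1.
  move=> TH Hu xyu neH.
  have xy'H: ~~ (H \subset <[x * y]>) by apply: contra neH => /(minL _ _ TH Txy)->.
  by apply/set1gP; rewrite -(prime_TIg (prG H TH) xy'H) inE Hu.
(* [x^-1 * y] and [x * y^-1] lie in neither [<[x]>] nor [<[y]>], hence in
   [<[x * y]>]; so do their quotients with [x * y], which are [x ^+ 2] and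
   [y ^+ 2]. *)
have ox: #[x] = 2.
  apply: nt_prime_order; rewrite ?(nt _ _ y'x) //.
  apply: (TI <[x]>%G); rewrite ?mem_cycle ?neqC //.
  have: x^-1 * y \in <[x * y]>.
    apply: LT; first by rewrite groupM ?groupV.
      by rewrite groupMl ?groupV ?cycle_id.
    by rewrite groupMr ?groupV ?cycle_id.
  rewrite -groupV invMg invgK => /(groupM (cycle_id (x * y))).
  by rewrite mulgA mulgK.
have oy: #[y] = 2.
  apply: nt_prime_order; rewrite ?(nt _ _ x'y) //.
  apply: (TI <[y]>%G); rewrite ?mem_cycle ?neqC //.
  have: x * y^-1 \in <[x * y]>.
    apply: LT; first by rewrite groupM ?groupV.
      by rewrite groupMl ?groupV ?cycle_id.
    by rewrite groupMr ?groupV ?cycle_id.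
  rewrite -groupV invMg invgK => /groupM/(_ (cycle_id (x * y))).
  by rewrite mulgA mulgKV.
(* Counting elements, [#|G| = #[x * y] + 2], while [#[x * y]] divides [#|G|]. *)
have := sum_card_prime_propers ncG; rewrite defL => /(_ prG).
rewrite /T -setUA big_setU1 ?inE ?neqC //= big_setU1 ?inE ?neqC //= big_set1 /=.
rewrite -!orderE ox oy => oG.
have oxy_gt0 := order_gt0 (x * y).
have {}oG: #|G| = #[x * y] + 2.
  rewrite -(prednK (cardG_gt0 G)) -oG; case: #[x * y] oxy_gt0 => // n _.
  by rewrite /= !add1n !addnS addn0.
have: #[x * y] %| #|G| by rewrite order_dvdG ?groupM.
by rewrite oG dvdn_addr // dvdn_prime2 ?(prG _ Txy) // => /eqP->.
Qed.

(** * Nonabelian groups of excess at most 4 *)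

(** If all were normal, the commutator of [x] and [y] would lie in both [<[x]>]
    and [<[y]>], which are equal or meet trivially. *)
Lemma exists_nonnormal_proper G : ~~ abelian G ->
    (forall H, H \in nt_propers G -> prime #|H|) ->
  exists2 A, A \in nt_propers G & ~~ (G \subset 'N(A)).
Proof.
move=> nabG prG; have ncG := contra (@cyclic_abelian _ G) nabG.
apply/(@exists_inP _ (mem (nt_propers G)) (fun A => ~~ (G \subset 'N(A)))).
apply: contraR nabG; rewrite negb_exists_in => /forall_inP allN.
apply/centsP=> x Gx y Gy; have [-> | ntx] := eqVneq x 1; first exact/commute_sym/commute1.
have [-> | nty] := eqVneq y 1; first exact: commute1.
have nsC z: z \in G -> z != 1 -> G \subset 'N(<[z]>).
  by move=> Gz ntz; apply/negbNE/(allN <[z]>%G)/cycle_nt_propers.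
have [x_y | TIxy] := boolP (<[x]> \subset <[y]>).
  by apply: (centsP (cycle_abelian y)); rewrite ?cycle_id // -cycle_subG.
apply/commgP; rewrite -in_set1 -[[set 1]]/(1 : {set gT}).
rewrite -(prime_TIg (prG <[x]>%G (cycle_nt_propers ncG Gx ntx)) TIxy) inE.
apply/andP; split.
  rewrite commgEl groupMl ?groupV ?cycle_id // memJ_norm ?cycle_id //.
  exact: (subsetP (nsC _ _ _)).
rewrite commgEr groupMr ?cycle_id // memJ_norm ?groupV ?cycle_id //.
exact: (subsetP (nsC _ _ _)).
Qed.

Lemma conj_nt_propers G H x :
  x \in G -> H \in nt_propers G -> (H :^ x)%G \in nt_propers G.
Proof.
move=> Gx /nt_propersP[ntH sHG neHG]; apply/nt_propersP; split=> /=.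
- by rewrite -cardG_gt1 cardJg cardG_gt1.
- by rewrite conj_subG.
by apply: contra neHG => /eqP HxG; rewrite eqEcard sHG -(cardJg H x) HxG /=.
Qed.

(** The normaliser is itself a proper nontrivial subgroup, so there is no room
    between it and [A]. *)
Lemma normaliser_nonnormal G A :
    (forall H, H \in nt_propers G -> prime #|H|) ->
  A \in nt_propers G -> ~~ (G \subset 'N(A)) -> 'N_G(A) = A.
Proof.
move=> prG LA nnA; have [ntA sAG _] := nt_propersP _ _ LA.
have sAN: A \subset 'N_G(A) by rewrite subsetI sAG normG.
have LN: 'N_G(A)%G \in nt_propers G.
  apply/nt_propersP; split; rewrite /= ?subsetIl //.
    by apply: contra ntA; rewrite -!subG1 => /(subset_trans sAN).
  by apply: contra nnA => /eqP/setIidPl.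
apply/esym/eqP; rewrite eqEcard sAN /= (eqP (_ : #|A| == #|'N_G(A)|)) //.
by rewrite -dvdn_prime2 ?cardSg // ?prG // -[#|'N_G(A)|]/(#|'N_G(A)%G|) prG.
Qed.

(** There are four proper nontrivial subgroups, all of prime order. The class of
    a nonnormal one is large enough to leave room for just one more subgroup,
    of order 3, which is then normal and self-centralising. *)
Lemma card6_of_nonabelian G : ~~ abelian G -> (excess G <= 4)%N -> #|G| = 6.
Proof.
move=> nabG leE4; have ncG := contra (@cyclic_abelian _ G) nabG.
have gt3: (3 < #|nt_propers G|)%N.
  rewrite ltnNge; apply: contra nabG => /(card4_of_three_propers ncG) oG.
  exact: (@card_p2group_abelian _ 2).
have prG := prime_of_excess_leq_card (leq_trans leE4 gt3).
have oL: #|nt_propers G| = 4.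
  by apply/eqP; rewrite eqn_leq gt3 andbT (leq_trans (leq_card_excess G)).
have [A LA nnA] := exists_nonnormal_proper nabG prG.
have NA := normaliser_nonnormal prG LA nnA.
pose C := orbit 'JG%act G A.
have CP H : H \in C -> #|H| = #|A| by case/imsetP=> x _ ->; apply: cardJg.
have sCL: C \subset nt_propers G.
  by apply/subsetP=> _ /imsetP[x Gx ->]; apply: conj_nt_propers.
have oG: (#|C| * #|A| = #|G|)%N by rewrite -{1}NA -(card_orbit_stab 'JG G A) astab1JG.
have prA := prG A LA.
have C_gt0: (0 < #|C|)%N by apply/card_gt0P; exists A; apply: orbit_refl.
have sumD: (\sum_(H in nt_propers G :\: C) #|H|.-1 = #|C|.-1)%N.
  have := sum_card_prime_propers ncG prG; rewrite (big_setID C) /= (setIidPr sCL).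
  rewrite (eq_bigr (fun=> #|A|.-1)) => [|H /CP->//]; rewrite sum_nat_const -oG.
  rewrite -{2}(prednK (prime_gt0 prA)) mulnSr -{3}(prednK C_gt0) addnS /=.
  exact: addnI.
have oD: (#|nt_propers G :\: C| = 4 - #|C|)%N by rewrite cardsD (setIidPr sCL) oL.
have leD: (#|nt_propers G :\: C| <= #|C|.-1)%N.
  rewrite -sumD -sum1_card; apply: leq_sum => H /setDP[/prG prH _].
  by rewrite -ltnS prednK ?prime_gt1 ?prime_gt0.
(* With [m = #|C|], the [4 - m] remaining subgroups need that many nonidentity
   elements among [m - 1], which gives [m >= 3]; and [m = 4] would leave 3
   elements uncovered. *)
have oC: #|C| = 3.
  have: #|C| != 4.
    apply/eqP=> oC; move: oD sumD; rewrite oC => /cards0_eq->.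
    by rewrite big_set0.
  have: (#|C| <= 4)%N by rewrite -oL subset_leq_card.
  by move: leD; rewrite oD; case: #|C| => [|[|[|[|[|]]]]].
have [K defK] : exists K, nt_propers G :\: C = [set K].
  by apply/cards1P; rewrite oD oC.
have [LK C'K]: K \in nt_propers G /\ K \notin C.
  by apply/setDP; rewrite defK set11.
have oK: #|K| = 3.
  by move: sumD; rewrite defK big_set1 oC; have := cardG_gt0 K; case: #|K| => //= n _ ->.
have [ntK sKG _] := nt_propersP _ _ LK.
have neA3: #|A| != 3.
  apply: contra nabG => /eqP oA; apply: (@card_p2group_abelian _ 3) => //.
  by rewrite -oG oC oA.
have [k Kk ok]: {k | k \in K & #[k] = 3} by apply: Cauchy; rewrite ?oK.
have Gk := subsetP sKG k Kk.
(* A central [k] would normalise [A], hence lie in [A], against [#|A| != 3]. *)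
have LC: 'C_G[k]%G \in nt_propers G.
  apply/nt_propersP; split; rewrite /= ?subsetIl //.
    rewrite -cardG_gt1; apply: leq_trans (subset_leq_card (_ : <[k]> \subset _)).
      by rewrite -orderE ok.
    by rewrite cycle_subG inE Gk cent1id.
  apply: contra neA3 => /eqP/setIidPl; rewrite sub_cent1 => cGk.
  have Nk: k \in 'N_G(A).
    have [_ sAG _] := nt_propersP _ _ LA.
    by rewrite inE Gk (subsetP (cent_sub A)) // (subsetP (centS sAG)).
  have: #[k] %| #|A| by rewrite order_dvdG // -NA.
  by rewrite ok dvdn_prime2 // eq_sym.
have oCk: #|'C_G[k]| = 3.
  apply/esym/eqP; rewrite -dvdn_prime2 ?(prG _ LC) // -ok order_dvdG //.
  by rewrite inE Gk cent1id.
(* [K] is the only subgroup of order 3, so it contains all conjugates of [k]. *)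
have sub_kG: k ^: G \subset K^#.
  apply/subsetP=> _ /imsetP[g Gg ->]; have Gkg: k ^ g \in G by rewrite groupJ.
  have ntkg: k ^ g != 1 by rewrite -order_gt1 orderJ ok.
  rewrite !inE ntkg /=; suffices /set1P/(congr1 val)/= <-: <[k ^ g]>%G \in [set K].
    exact: cycle_id.
  rewrite -defK inE cycle_nt_propers // andbT.
  by apply: contra neA3 => /CP <-; rewrite /= -orderE orderJ ok.
have leA: (#|A| <= 2)%N.
  have <-: #|k ^: G| = #|A|.
    rewrite -index_cent1; apply/eqP; rewrite -(eqn_pmul2l (isT : 0 < 3)%N).
    by rewrite -[X in (X * _ == _)%N]oCk Lagrange ?subsetIl // -oG oC.
  apply: leq_trans (subset_leq_card sub_kG) _.
  by have:= cardsD1 1 K; rewrite group1 oK add1n => -[<-].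
have oA: #|A| = 2 by apply/eqP; rewrite eqn_leq leA prime_gt1.
by rewrite -oG oC oA.
Qed.

(** * The two exceptional groups *)

(** A subgroup of order 3 uses up two of the five nonidentity elements, so there
    are at most four proper nontrivial subgroups; three are not enough by
    [card4_of_three_propers]. *)
Lemma excess_nonabelian6 G : ~~ abelian G -> #|G| = 6 -> excess G = 4.
Proof.
move=> nabG oG; have ncG := contra (@cyclic_abelian _ G) nabG.
have oL H: H \in nt_propers G -> #|H| = 2 \/ #|H| = 3.
  case/nt_propersP=> ntH sHG neHG.
  have: #|H| \in divisors 6 by rewrite -dvdn_divisors // -oG cardSg.
  rewrite !inE => /or4P[] /eqP oH; [|by left|by right|].
    by case/negP: ntH; rewrite trivg_card1 oH.
  by case/eqP: neHG; apply/eqP; rewrite eqEcard sHG oG oH.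
have prG H: H \in nt_propers G -> prime #|H| by case/oL=> ->.
have [k Gk ok]: {k | k \in G & #[k] = 3} by apply: Cauchy; rewrite ?oG.
have LK: <[k]>%G \in nt_propers G.
  by apply: cycle_nt_propers; rewrite // -order_gt1 ok.
rewrite excess_eq_card //; apply/eqP; rewrite eqn_leq; apply/andP; split; last first.
  rewrite ltnNge; apply/negP=> /(card4_of_three_propers ncG); by rewrite oG.
have := sum_card_prime_propers ncG prG.
rewrite (bigD1 _ LK) (cardsD1 <[k]>%G) LK /= -orderE ok oG /= => -[sumL].
rewrite -[4]/(1 + 3)%N leq_add2l -sumL -sum1_card.
rewrite big_mkcond [leqRHS]big_mkcond; apply: leq_sum => H _.
by rewrite in_setD1 andbC; case: ifP => // /andP[/oL[]->].
Qed.

Lemma excess_noncyclic4 G : ~~ cyclic G -> #|G| = 4 -> excess G = 3.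
Proof.
move=> ncG oG.
have oL H: H \in nt_propers G -> #|H| = 2.
  case/nt_propersP=> ntH sHG neHG.
  have: #|H| \in divisors 4 by rewrite -dvdn_divisors // -oG cardSg.
  rewrite !inE => /or3P[] /eqP oH; [|by []|]; first by case/negP: ntH; rewrite trivg_card1 oH.
  by case/eqP: neHG; apply/eqP; rewrite eqEcard sHG oG oH.
have prG H: H \in nt_propers G -> prime #|H| by move/oL->.
rewrite excess_eq_card // -sum1_card.
have := sum_card_prime_propers ncG prG; rewrite oG /= => <-.
by apply: eq_bigr => H /oL->.
Qed.

(** An involution [x] is not central, as otherwise the central quotient would be
    cyclic; [x] and a distinct conjugate then generate a subgroup of even order
    greater than 2, which is [G]. *)
Lemma nonabelian6_isog_dihedral G : ~~ abelian G -> #|G| = 6 -> G \isog 'D_6.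
Proof.
move=> nabG oG; have [x Gx ox]: {x | x \in G & #[x] = 2} by apply: Cauchy; rewrite ?oG.
have [y Gy neyx]: exists2 y, y \in G & x != x ^ y.
  apply/(@exists_inP _ (mem G) (fun y => x != x ^ y)); apply: contraR nabG.
  rewrite negb_exists_in => /forall_inP cGx.
  have Zx: x \in 'Z(G).
    rewrite inE Gx; apply/centP=> y Gy; apply/commgP; rewrite -conjg_fix eq_sym.
    exact/negbNE/cGx.
  apply: cyclic_center_factor_abelian; have: #|G / 'Z(G)| %| 3.
    rewrite card_quotient ?gFnorm // -(dvdn_pmul2l (isT : 0 < 2)%N) -[(2 * 3)%N]oG.
    by rewrite -(Lagrange (center_sub G)) dvdn_pmul2r // -ox order_dvdG.
  rewrite dvdn_divisors // !inE => /orP[] /eqP oQ; last by rewrite prime_cyclic ?oQ.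
  by rewrite (card1_trivg oQ) cyclic1.
have oxy: #[x ^ y] = 2 by rewrite orderJ.
have := involutions_gen_dihedral ox oxy neyx.
suffices ->: <<[set x; x ^ y]>> = G by rewrite oG.
apply/eqP; rewrite eqEcard gen_subG subUset !sub1set Gx groupJ //=.
have sDG: <<[set x; x ^ y]>> \subset G.
  by rewrite gen_subG subUset !sub1set Gx groupJ.
have gt2: 2 < #|<<[set x; x ^ y]>>|.
  apply: leq_trans (subset_leq_card (_ : [set 1; x; x ^ y] \subset _)).
    rewrite -setUA !cardsU1 cards1 !inE neyx [1 == x]eq_sym [1 == _]eq_sym.
    by rewrite -!order_eq1 ox oxy.
  by rewrite -setUA subUset sub1set group1 subset_gen.
have even: 2 %| #|<<[set x; x ^ y]>>| by rewrite -ox order_dvdG // mem_gen ?set21.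
have: #|<<[set x; x ^ y]>>| \in divisors 6 by rewrite -dvdn_divisors // -oG cardSg.
by move: gt2 even; rewrite !inE oG => gt2 even /or4P[] /eqP oD; rewrite oD in gt2 even *.
Qed.

Lemma noncyclic4_abelem G : ~~ cyclic G -> #|G| = 4 -> 2.-abelem G.
Proof.
move=> ncG oG; apply/abelemP=> //; split.
  exact: (@card_p2group_abelian _ 2).
move=> x Gx; apply/eqP; rewrite -order_dvdn.
have: #[x] \in divisors 4 by rewrite -dvdn_divisors // -oG order_dvdG.
rewrite !inE => /or3P[] /eqP ox; rewrite ox //.
case/negP: ncG; apply/cyclicP; exists x; apply/eqP.
by rewrite eq_sym eqEcard cycle_subG Gx -orderE oG ox.
Qed.

End SubgroupCounting.

Lemma klein4_abelem : (2.-abelem klein4)%g.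
Proof.
apply/abelemP=> //; split; last by case=> a b _; apply/eqP; move: a b; do 2!case=> [[|[|]]] ? //.
apply/centsP=> [[a b] _ [c d] _]; congr (_, _); apply: Zp_mulgC.
Qed.

Lemma card_klein4 : #|klein4| = 4%N.
Proof. by rewrite cardsT card_prod !card_ord. Qed.

Lemma sym3_nonabelian : ~~ abelian sym3.
Proof.
pose a : 'I_3 := ord0; pose b : 'I_3 := lift ord0 ord0; pose c : 'I_3 := ord_max.
apply/negP=> /centsP/(_ (tperm a b) (in_setT _) (tperm b c) (in_setT _)).
move/permP/(_ a); rewrite !permM (tpermD (isT : b != a) (isT : c != a)).
by rewrite !tpermL.
Qed.

Lemma card_sym3 : #|sym3| = 6%N.
Proof. by rewrite cardsT card_Sn. Qed.

Lemma sigma1_noncyclic (gT : finGroupType) (G : {group gT}) :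
  ~~ cyclic G -> sigma1 G = 2 + (excess G)%:R / #|G|%:R.
Proof.
move=> ncG; have n_neq0: #|G|%:R != 0 :> rat by rewrite pnatr_eq0 -lt0n cardG_gt0.
rewrite /sigma1 -mulr_suml -natr_sum sum_card_subgroups // natrD natrM mulrDl.
by rewrite mulfK.
Qed.

Theorem corollary2 :
  (forall (gT : finGroupType) (G : {group gT}),
      (~~ cyclic G /\ sigma1 G < 2 + 4 / #|G|%:R) <-> G \isog klein4)
  /\
  (forall (gT : finGroupType) (G : {group gT}),
      (~~ abelian G /\ sigma1 G = 2 + 4 / #|G|%:R) <-> G \isog sym3).
Proof.
split=> gT G.
  have invn_gt0: 0 < (#|G|%:R)^-1 :> rat by rewrite invr_gt0 ltr0n cardG_gt0.
  have lt4 : ~~ cyclic G -> (sigma1 G < 2 + 4 / #|G|%:R) = (excess G < 4)%N.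
    by move=> ncG; rewrite sigma1_noncyclic // ltrD2l ltr_pM2r // ltr_nat.
  split=> [[ncG] | isoG].
    rewrite lt4 // ltnS => leE3.
    have oG := card4_of_three_propers ncG (leq_trans (leq_card_excess G) leE3).
    rewrite (isog_abelem_card _ (noncyclic4_abelem ncG oG)) klein4_abelem.
    by rewrite card_klein4 oG.
  have oG: #|G| = 4%N by rewrite (card_isog isoG) card_klein4.
  have ncG: ~~ cyclic G.
    by rewrite (isog_cyclic isoG) (abelem_cyclic klein4_abelem) card_klein4.
  by rewrite lt4 // excess_noncyclic4.
have invn_neq0: (#|G|%:R)^-1 != 0 :> rat by rewrite invr_eq0 pnatr_eq0 -lt0n cardG_gt0.
split=> [[nabG] | isoG].
  have ncG := contra (@cyclic_abelian _ G) nabG.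
  rewrite sigma1_noncyclic // => /addrI/(mulIf invn_neq0)/eqP.
  rewrite eqr_nat => /eqP E4.
  have oG: #|G| = 6%N by apply: card6_of_nonabelian; rewrite ?E4.
  apply: isog_trans (nonabelian6_isog_dihedral nabG oG) _.
  by rewrite isog_sym nonabelian6_isog_dihedral ?sym3_nonabelian ?card_sym3.
have oG: #|G| = 6%N by rewrite (card_isog isoG) card_sym3.
have nabG: ~~ abelian G by rewrite (isog_abelian isoG) sym3_nonabelian.
split=> //; rewrite sigma1_noncyclic ?excess_nonabelian6 //.
by apply: contra nabG; apply: cyclic_abelian.
Qed.
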